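(* Let $R$ be a commutative Noetherian local ring with maximal ideal $\mathfrak m$ and $\dim R\le 2$, and let $\mathfrak a$ be an ideal of $R$. Let $M$ be a finitely generated $R$-module and $X$ an arbitrary $R$-module such that $\Gamma_{\mathfrak a}(X)$ is weakly Laskerian. Then $\operatorname{Ass}_R(H^i_{\mathfrak a}(M,X))$ is finite for all $i$.
   Context: $H^i_{\mathfrak a}(M,X)=\varinjlim_{k}\operatorname{Ext}^i_R(M/\mathfrak a^kM,X)$ is the $i$-th generalized local cohomology module. $\Gamma_{\mathfrak a}(X)=\{x\in X:\mathfrak a^kx=0\text{ for some }k\}$. An $R$-module $Y$ is weakly Laskerian if every quotient module of $Y$ has only finitely many associated primes. *)

(* Defs.v *)
From HB Require Import structures.
From mathcomp Require Import all_boot all_order all_algebra.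
From mathcomp Require Import ring_quotient generic_quotient.
From mathcomp Require Import mathcomp_extra boolp classical_sets functions.
From mathcomp Require Import cardinality.
From mathcomp Require Import freeg.

Set Implicit Arguments.
Unset Strict Implicit.
Unset Printing Implicit Defensive.

Import GRing.Theory.

Local Open Scope quotient_scope.
Local Open Scope classical_set_scope.
Local Open Scope ring_scope.

Section Span.
Variables (R : comNzRingType) (V : lmodType R).

Definition spanmod (A : set V) : {pred V} :=
  [pred x | `[< smallest [set S : set V | submod_closed [in S]] A x >] ].

Lemma span_submod_closed A : submod_closed (spanmod A).
Proof.
split; first by apply/asboolP => S [[S0 _] _]; rewrite -in_setE.
move=> a x y /asboolP Sx /asboolP Sy; apply/asboolP => S [cS AS].
by rewrite -in_setE; apply: cS.2; rewrite in_setE; [apply: Sx|apply: Sy].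
Qed.

HB.instance Definition _ A :=
  GRing.isSubmodClosed.Build R V (spanmod A) (span_submod_closed A).

Lemma mem_span A x : A x -> x \in spanmod A.
Proof. by move=> Ax; apply/asboolP => S [_]; apply. Qed.

Lemma span_sub A (U : submodClosed V) :
  (forall x, A x -> x \in U) -> {subset spanmod A <= U}.
Proof.
move=> AU x /asboolP /(_ [set` U]); apply; split=> //.
split=> [|a y z]; first by rewrite in_setE /= rpred0.
by rewrite !in_setE/= => Uy Uz; rewrite rpredD ?rpredZ.
Qed.

Definition finitely_generated := exists s : seq V, forall x, x \in spanmod [set` s].

(* I A, the submodule generated by the products r x with r in I, x in A *)
Definition idealM (I : {pred R}) (A : {pred V}) : {pred V} :=
  spanmod [set r *: x | r in [set` I] & x in [set` A]].

HB.instance Definition _ I A := GRing.SubmodClosed.on (idealM I A).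

End Span.

Arguments finitely_generated {R} V.

Section Ideals.
Variable R : comNzRingType.
Implicit Types (I p m : {pred R}).

Fixpoint idealX I k : {pred R} :=
  if k is k'.+1 then idealM (V := R^o) I (idealX I k') else predT.

(* unlike the library's [idealr_closed], allows the unit ideal *)
Definition ideal I := submod_closed (I : {pred R^o}).

Definition noetherian := forall I, ideal I ->
  exists s : seq R, I =i spanmod (V := R^o) [set` s].

Definition prime_ideal p := idealr_closed p /\ prime_idealr_closed p.

Definition maximal_ideal m :=
  idealr_closed m /\
  forall I, idealr_closed I -> {subset m <= I} -> I =i m.

Definition local_ring m :=
  maximal_ideal m /\ forall m', maximal_ideal m' -> m' =i m.

(* every chain p_0 < p_1 < ... < p_l of prime ideals has length l <= n *)
Definition krull_dim_le n := forall (l : nat) (p : nat -> {pred R}),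
  (forall i, (i <= l)%N -> prime_ideal (p i)) ->
  (forall i, (i < l)%N ->
     {subset p i <= p i.+1} /\ ~ {subset p i.+1 <= p i}) ->
  (l <= n)%N.

Lemma idealX_ideal I k : ideal (idealX I k).
Proof. case: k => [//|k]; exact: span_submod_closed. Qed.

Lemma idealX_sub I k l : (k <= l)%N -> {subset idealX I l <= idealX I k}.
Proof.
elim: l k => [|l IHl] k; first by rewrite leqn0 => /eqP ->.
rewrite leq_eqVlt => /predU1P[-> //|kl] x xl; apply: (IHl k kl).
pose HB := GRing.isSubmodClosed.Build R R^o (idealX I l : {pred R^o})
  (idealX_ideal I l : submod_closed (idealX I l : {pred R^o})).
pose J : submodClosed R^o := HB.pack (idealX I l : R^o -> bool) HB.
apply: (@span_sub _ R^o _ J _ x xl) => _ [r Ir [y Jy <-]].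
exact: (@rpredZ _ _ J r y Jy).
Qed.

End Ideals.

Section Torsion.
Variables (R : comNzRingType) (a : {pred R}) (X : lmodType R).

Definition torsion : {pred X} :=
  [pred x | `[< exists k, forall r, r \in idealX a k -> r *: x = 0 >] ].

Lemma torsion_submod_closed : submod_closed torsion.
Proof.
split; first by apply/asboolP; exists 0%N => r _; rewrite scaler0.
move=> c x y /asboolP[k xk] /asboolP[l yl]; apply/asboolP.
exists (maxn k l) => r rkl.
rewrite scalerDr scalerA mulrC -scalerA xk ?yl ?scaler0 ?addr0//.
  exact: idealX_sub (leq_maxr k l) _ rkl.
exact: idealX_sub (leq_maxl k l) _ rkl.
Qed.

HB.instance Definition _ :=
  GRing.isSubmodClosed.Build R X torsion torsion_submod_closed.

End Torsion.

Arguments torsion {R} a X.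

Section Submodules.
Variables (R : comNzRingType) (V : lmodType R) (U : submodClosed V).

Definition submod := {x : V | x \in U}.

HB.instance Definition _ := SubChoice.on submod.
HB.instance Definition _ := [SubChoice_isSubLmodule of submod by <:].

End Submodules.

Section Quotients.
Variables (R : comNzRingType) (V : lmodType R) (U : submodClosed V).

Fact submod_zmod_closed : zmod_closed U.
Proof. by split=> [|x y Ux Uy]; rewrite ?rpred0// -scaleN1r rpredD ?rpredZ. Qed.

Definition submod_zmod : zmodClosed V :=
  HB.pack (GRing.SubmodClosed.sort U)
    (GRing.isZmodClosed.Build V (GRing.SubmodClosed.sort U) submod_zmod_closed).

Definition quotmod := Quotient.quot submod_zmod.

HB.instance Definition _ := GRing.Zmodule.on quotmod.
HB.instance Definition _ := Quotient.on quotmod.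

Definition to_quot (x : V) : quotmod := \pi x.

Lemma to_quotP x y : to_quot x = to_quot y <-> x - y \in U.
Proof. by rewrite (Quotient.idealrBE submod_zmod); split=> /eqP. Qed.

Lemma to_quotK (q : quotmod) : to_quot (repr q) = q.
Proof. exact: reprK. Qed.

Lemma to_quot_is_additive : zmod_morphism to_quot.
Proof. exact: (raddfB (\pi_(Quotient.quot submod_zmod))). Qed.

Definition quot_scale (c : R) (q : quotmod) : quotmod := to_quot (c *: repr q).

Lemma to_quot_is_scalable c x : quot_scale c (to_quot x) = to_quot (c *: x).
Proof. by apply/to_quotP; rewrite -scalerBr rpredZ//; apply/to_quotP/to_quotK. Qed.

Fact quot_scaleA c d q : quot_scale c (quot_scale d q) = quot_scale (c * d) q.
Proof. by rewrite -[q]to_quotK !to_quot_is_scalable scalerA. Qed.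

Fact quot_scale1 : left_id 1 quot_scale.
Proof. by move=> q; rewrite -[q]to_quotK to_quot_is_scalable scale1r. Qed.

HB.instance Definition _ :=
  GRing.isZmodMorphism.Build V quotmod to_quot to_quot_is_additive.

Fact quot_scaleDr : right_distributive quot_scale +%R.
Proof.
move=> c q r; rewrite -[q]to_quotK -[r]to_quotK -raddfD.
by rewrite !to_quot_is_scalable scalerDr raddfD.
Qed.

Fact quot_scaleDl q : {morph quot_scale^~ q : c d / c + d}.
Proof.
by move=> c d; rewrite -[q]to_quotK !to_quot_is_scalable scalerDl raddfD.
Qed.

HB.instance Definition _ := GRing.Zmodule_isLmodule.Build R quotmod
  quot_scaleA quot_scale1 quot_scaleDr quot_scaleDl.

HB.instance Definition _ := GRing.isScalable.Build R V quotmod *:%R to_quot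
  (fun c x => esym (to_quot_is_scalable c x)).

End Quotients.

Section QuotientMap.
Variables (R : comNzRingType) (V W : lmodType R).
Variables (U : submodClosed V) (U' : submodClosed W) (f : {linear V -> W}).
Hypothesis fU : forall x, x \in U -> f x \in U'.

Definition quot_map of (forall x, x \in U -> f x \in U') :=
  fun q : quotmod U => to_quot U' (f (repr q)).

Lemma quot_mapE x : quot_map fU (to_quot U x) = to_quot U' (f x).
Proof. by apply/to_quotP; rewrite -raddfB; apply/fU/to_quotP/to_quotK. Qed.

Fact quot_map_is_linear : linear (quot_map fU).
Proof.
move=> c q r; rewrite -[q]to_quotK -[r]to_quotK -linearP.
by rewrite !quot_mapE !linearP.
Qed.

HB.instance Definition _ := GRing.isLinear.Build R (quotmod U) (quotmod U')
  *:%R (quot_map fU) quot_map_is_linear.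

End QuotientMap.

Section SubmoduleMap.
Variables (R : comNzRingType) (V W : lmodType R).
Variables (U : submodClosed V) (U' : submodClosed W) (f : {linear V -> W}).
Hypothesis fU : forall x, x \in U -> f x \in U'.

Definition sub_map (u : submod U) : submod U' :=
  exist _ (f (val u)) (fU (valP u)).

Fact sub_map_is_linear : linear sub_map.
Proof. by move=> c u v; apply: val_inj; rewrite /= !linearP. Qed.

HB.instance Definition _ := GRing.isLinear.Build R (submod U) (submod U')
  *:%R sub_map sub_map_is_linear.

End SubmoduleMap.

Section Kernel.
Variables (R : comNzRingType) (V W : lmodType R) (f : {linear V -> W}).

Definition lin_ker : {pred V} := [pred x | f x == 0].

Fact ker_submod_closed : submod_closed lin_ker.
Proof.
split=> [|c x y]; rewrite !inE ?linear0// linearP.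
by move=> /eqP-> /eqP->; rewrite scaler0 addr0.
Qed.

HB.instance Definition _ :=
  GRing.isSubmodClosed.Build R V lin_ker ker_submod_closed.

End Kernel.

Section FreeResolution.
Variable R : comNzRingType.

Definition free_mod (N : lmodType R) := {freeg N / R}.

HB.instance Definition _ N := GRing.Lmodule.on (free_mod N).

Section Lift.
Variables (N W : lmodType R) (f : N -> W).

Definition free_lift : free_mod N -> W := fglift f.

Fact free_lift_is_additive : zmod_morphism free_lift.
Proof. exact: lift_is_additive. Qed.

HB.instance Definition _ := GRing.isZmodMorphism.Build (free_mod N) W free_lift
  free_lift_is_additive.

Lemma free_liftU k x : free_lift << k *g x >> = k *: f x.
Proof. exact: liftU. Qed.

Fact free_lift_is_scalable : scalable free_lift.
Proof.
move=> c D.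
have [s ->] : exists s : seq (R * N),
    D = \sum_(kx <- s) (<< kx.1 *g kx.2 >> : free_mod N).
  exists [seq (coeff x D, x) | x <- dom D].
  by rewrite big_map; apply/esym/freeg_sumE.
rewrite scaler_sumr !raddf_sum; apply: eq_bigr => -[k x] _ /=.
have -> : c *: (<< k *g x >> : free_mod N) = << (c * k) *g x >>.
  by apply/eqP/freeg_eqP => y; rewrite coeffZ !coeffU mulrA.
by rewrite !free_liftU scalerA.
Qed.

HB.instance Definition _ := GRing.isScalable.Build R (free_mod N) W *:%R free_lift
  free_lift_is_scalable.

End Lift.

Definition free_aug (N : lmodType R) : {linear free_mod N -> N} := free_lift id.

Lemma free_aug_surj (N : lmodType R) (x : N) : exists y, free_aug N y = x.
Proof. by exists << x >>; rewrite /= free_liftU scale1r. Qed.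

Definition free_map (N N' : lmodType R) (f : N -> N') :
  {linear free_mod N -> free_mod N'} := free_lift (fun x => << f x >>).

Lemma free_mapE (N N' : lmodType R) (f : {linear N -> N'}) (x : free_mod N) :
  free_aug N' (free_map f x) = f (free_aug N x).
Proof.
have [s ->] : exists s : seq (R * N),
    x = \sum_(kx <- s) (<< kx.1 *g kx.2 >> : free_mod N).
  exists [seq (coeff y x, y) | y <- dom x].
  by rewrite big_map; apply/esym/freeg_sumE.
rewrite !linear_sum; apply: eq_bigr => -[k y] _ /=.
by rewrite !free_liftU !linearZ /= free_liftU scale1r.
Qed.

Definition syzygy (N : lmodType R) : lmodType R :=
  submod (lin_ker (free_aug N)).

Definition syzygy_incl (N : lmodType R) : {linear syzygy N -> free_mod N} :=
  \val.

Lemma syzygy_incl_inj (N : lmodType R) : injective (syzygy_incl N).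
Proof. exact: val_inj. Qed.

Lemma syzygy_exact (N : lmodType R) x :
  free_aug N x = 0 <-> exists z, x = syzygy_incl N z.
Proof.
split=> [x0|[z ->]]; last by apply/eqP; exact: valP z.
have kx : x \in lin_ker (free_aug N) by rewrite inE x0.
by exists (exist (fun y => y \in lin_ker (free_aug N)) x kx).
Qed.

Fact free_map_ker (N N' : lmodType R) (f : {linear N -> N'}) x :
  x \in lin_ker (free_aug N) -> free_map f x \in lin_ker (free_aug N').
Proof. by rewrite !inE free_mapE => /eqP->; rewrite linear0. Qed.

Definition syzygy_map (N N' : lmodType R) (f : {linear N -> N'}) :
  {linear syzygy N -> syzygy N'} := sub_map (@free_map_ker _ _ f).

Lemma syzygy_inclE (N N' : lmodType R) (f : {linear N -> N'}) z :
  syzygy_incl N' (syzygy_map f z) = free_map f (syzygy_incl N z).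
Proof. by []. Qed.

(* The standard free resolution
     ... -> res 2 N -> res 1 N -> res 0 N -> N,
   functorial in N: res 0 N is the free module on the set N, syz 1 N the kernel
   of the evaluation res 0 N -> N, res 1 N the free module on the set syz 1 N,
   and so on. *)
Fixpoint syz n (N : lmodType R) : lmodType R :=
  if n is n'.+1 then syzygy (syz n' N) else N.

Definition res n (N : lmodType R) : lmodType R := free_mod (syz n N).

Definition res_diff n (N : lmodType R) : {linear res n.+1 N -> res n N} :=
  syzygy_incl (syz n N) \o free_aug (syz n.+1 N).

Lemma res_exact0 N x : free_aug N x = 0 <-> exists y, x = res_diff 0 N y.
Proof.
apply: (iff_trans (syzygy_exact x)); split=> [[z ->]|[y ->]].
  by have [y <-] := free_aug_surj z; exists y.
by exists (free_aug (syzygy N) y).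
Qed.

Lemma res_exact n N x :
  res_diff n N x = 0 <-> exists y, x = res_diff n.+1 N y.
Proof.
have d0 : (res_diff n N x = 0) <-> (free_aug (syz n.+1 N) x = 0).
  split=> [x0|x0].
    by apply: (@syzygy_incl_inj (syz n N)); rewrite linear0.
  by rewrite -[LHS]/(syzygy_incl _ (free_aug (syz n.+1 N) x)) x0 linear0.
apply: (iff_trans d0); apply: (iff_trans (syzygy_exact x)).
split=> [[z ->]|[y ->]]; last by exists (free_aug (syz n.+2 N) y).
by have [y <-] := free_aug_surj z; exists y.
Qed.

Fixpoint syz_map n (N N' : lmodType R) (f : {linear N -> N'}) :
    {linear syz n N -> syz n N'} :=
  match n return {linear syz n N -> syz n N'} with
  | 0 => f
  | n'.+1 => syzygy_map (syz_map n' f)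
  end.

Definition res_map n (N N' : lmodType R) (f : {linear N -> N'}) :
  {linear res n N -> res n N'} := free_map (syz_map n f).

Lemma res_diff_map n (N N' : lmodType R) (f : {linear N -> N'}) x :
  res_diff n N' (res_map n.+1 f x) = res_map n f (res_diff n N x).
Proof.
rewrite -[RHS](syzygy_inclE (syz_map n f)).
by congr (syzygy_incl _ _); exact: (free_mapE (syz_map n.+1 f)).
Qed.

End FreeResolution.

Section Ext.
Variables (R : comNzRingType) (i : nat) (N X : lmodType R).

Definition cocycle : {pred (res i N -> X)} :=
  [pred h | `[< linear h /\ forall x, h (res_diff i N x) = 0 >] ].

Fact cocycle_submod_closed : submod_closed cocycle.
Proof.
split; first by apply/asboolP; split=> // c x y; rewrite /= scaler0 addr0.
move=> c g h /asboolP[lg g0] /asboolP[lh h0]; apply/asboolP; split=> [d x y|x].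
  rewrite -[RHS]/(d *: (c *: g x + h x) + (c *: g y + h y)).
  rewrite -[LHS]/(c *: g (d *: x + y) + h (d *: x + y)) lg lh.
  by rewrite !scalerDr !scalerA mulrC addrACA.
by rewrite -[LHS]/(c *: g _ + h _) g0 h0 scaler0 addr0.
Qed.

HB.instance Definition _ := GRing.isSubmodClosed.Build R (res i N -> X)
  cocycle cocycle_submod_closed.

Definition is_coboundary : (res i N -> X) -> Prop :=
  match i return (res i N -> X) -> Prop with
  | 0 => fun h => forall x, h x = 0
  | j.+1 => fun h =>
      exists g : {linear res j N -> X}, forall x, h x = g (res_diff j N x)
  end.

End Ext.

Arguments cocycle {R} i N X.
Arguments is_coboundary {R} i N X h.

Section ExtModule.
Variables (R : comNzRingType) (i : nat) (N X : lmodType R).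

Definition coboundary : {pred submod (cocycle i N X)} :=
  [pred u | `[< is_coboundary i N X (val u) >] ].

Fact coboundary_submod_closed : submod_closed coboundary.
Proof.
rewrite /coboundary; case: i => [|j]; split.
- by apply/asboolP.
- move=> c u v /asboolP u0 /asboolP v0; apply/asboolP => x.
  by rewrite -[LHS]/(c *: val u x + val v x) u0 v0 scaler0 addr0.
- by apply/asboolP; exists \0.
- move=> c u v /asboolP[g ug] /asboolP[h vh]; apply/asboolP.
  exists ((c \*: g) \+ h) => x.
  by rewrite -[LHS]/(c *: val u x + val v x) ug vh.
Qed.

HB.instance Definition _ := GRing.isSubmodClosed.Build R _
  coboundary coboundary_submod_closed.

(* H^i (Hom (F_., X)), for F_. the standard free resolution [res] of N *)
Definition Ext := quotmod coboundary.

HB.instance Definition _ := GRing.Lmodule.on Ext.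

End ExtModule.

Arguments coboundary {R} i N X.
Arguments Ext {R} i N X.

Section ExtMap.
Variables (R : comNzRingType) (i : nat) (X N N' : lmodType R).
Variable f : {linear N -> N'}.

Definition precomp (h : res i N' -> X) : res i N -> X := h \o res_map i f.

Fact precomp_is_linear : linear precomp.
Proof. by []. Qed.

HB.instance Definition _ := GRing.isLinear.Build R _ _ *:%R precomp
  precomp_is_linear.

Fact precomp_cocycle h :
  h \in cocycle i N' X -> precomp h \in cocycle i N X.
Proof.
move=> /asboolP[lh h0]; apply/asboolP; split=> [c x y|x].
  by rewrite /precomp /= linearP lh.
by rewrite /precomp /= -res_diff_map h0.
Qed.

Fact precomp_coboundary u :
  u \in coboundary i N' X -> sub_map precomp_cocycle u \in coboundary i N X.
Proof.
move: u; rewrite /coboundary => u /asboolP bu; apply/asboolP; move: bu => /=.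
move: (val u) => {u}; rewrite /precomp; case: i => [|j] h /=.
  by move=> h0 x; apply: h0.
move=> [g hg]; exists (g \o res_map j f) => x.
by rewrite hg; congr (g _); exact: res_diff_map.
Qed.

Definition Ext_map : {linear Ext i N' X -> Ext i N X} :=
  quot_map precomp_coboundary.

End ExtMap.

Section Product.
Variables (R : comNzRingType) (A : nat -> lmodType R).

Definition seqprod := forall k, A k.

HB.instance Definition _ := Choice.on seqprod.

Let zero : seqprod := fun=> 0.
Let opp (x : seqprod) : seqprod := fun k => - x k.
Let add (x y : seqprod) : seqprod := fun k => x k + y k.
Let scale (c : R) (x : seqprod) : seqprod := fun k => c *: x k.

Fact seqprod_addA : associative add.
Proof. by move=> x y z; apply/functional_extensionality_dep => k; apply: addrA. Qed.

Fact seqprod_addC : commutative add.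
Proof. by move=> x y; apply/functional_extensionality_dep => k; apply: addrC. Qed.

Fact seqprod_add0 : left_id zero add.
Proof. by move=> x; apply/functional_extensionality_dep => k; apply: add0r. Qed.

Fact seqprod_addN : left_inverse zero opp add.
Proof. by move=> x; apply/functional_extensionality_dep => k; apply: addNr. Qed.

HB.instance Definition _ := GRing.isZmodule.Build seqprod
  seqprod_addA seqprod_addC seqprod_add0 seqprod_addN.

Fact seqprod_scaleA c d x : scale c (scale d x) = scale (c * d) x.
Proof. by apply/functional_extensionality_dep => k; apply: scalerA. Qed.

Fact seqprod_scale1 : left_id 1 scale.
Proof. by move=> x; apply/functional_extensionality_dep => k; apply: scale1r. Qed.

Fact seqprod_scaleDr : right_distributive scale +%R.
Proof.
by move=> c x y; apply/functional_extensionality_dep => k; apply: scalerDr.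
Qed.

Fact seqprod_scaleDl x : {morph scale^~ x : c d / c + d}.
Proof.
by move=> c d; apply/functional_extensionality_dep => k; apply: scalerDl.
Qed.

HB.instance Definition _ := GRing.Zmodule_isLmodule.Build R seqprod
  seqprod_scaleA seqprod_scale1 seqprod_scaleDr seqprod_scaleDl.

Definition finite_seq : {pred seqprod} :=
  [pred x | `[< exists n, forall k, (n <= k)%N -> x k = 0 >] ].

Fact finite_seq_submod_closed : submod_closed finite_seq.
Proof.
split; first by apply/asboolP; exists 0%N.
move=> c x y /asboolP[m xm] /asboolP[n yn]; apply/asboolP.
exists (maxn m n) => k; rewrite geq_max => /andP[mk nk].
by rewrite -[LHS]/(c *: x k + y k) xm ?yn ?scaler0 ?addr0.
Qed.

HB.instance Definition _ :=
  GRing.isSubmodClosed.Build R seqprod finite_seq finite_seq_submod_closed.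

Definition dsum := submod finite_seq.

HB.instance Definition _ := GRing.Lmodule.on dsum.

Fact dsum_in_finite k (x : A k) :
  (dfwith (fun l => 0 : A l) k x : seqprod) \in finite_seq.
Proof.
apply/asboolP; exists k.+1 => l kl; rewrite dfwithout//.
by rewrite neq_ltn kl.
Qed.

Definition dsum_in k (x : A k) : dsum :=
  exist (fun y => y \in finite_seq) _ (dsum_in_finite x).

End Product.

Section DirectLimit.
Variables (R : comNzRingType) (A : nat -> lmodType R).
Variable t : forall k, {linear A k -> A k.+1}.

(* the direct sum of the A_k, modulo the identifications of x with t_k x *)
Definition direct_limit : lmodType R :=
  quotmod (spanmod [set d : dsum A |
    exists k (x : A k), d = dsum_in x - dsum_in (t k x)]).

End DirectLimit.

Section LocalCohomology.
Variables (R : comNzRingType) (a : {pred R}) (M X : lmodType R).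

Definition powM k : {pred M} := idealM (idealX a k) predT.

HB.instance Definition _ k := GRing.SubmodClosed.on (powM k).

Fact powM_sub k x : x \in powM k.+1 -> idfun x \in powM k.
Proof.
apply: span_sub => _ [r ark [y My <-]]; apply: mem_span.
by exists r; [exact: idealX_sub (leqnSn k) _ ark | exists y].
Qed.

(* the projection M / a^(k+1) M -> M / a^k M *)
Definition pow_proj k : {linear quotmod (powM k.+1) -> quotmod (powM k)} :=
  quot_map (@powM_sub k).

Definition gen_local_cohomology i : lmodType R :=
  direct_limit (fun k => Ext_map i X (pow_proj k)).

End LocalCohomology.

Section AssociatedPrimes.
Variables (R : comNzRingType) (V : lmodType R).

Definition annihilator (x : V) : {pred R} := [pred r | r *: x == 0].

Definition Ass : set {pred R} :=
  [set p | prime_ideal p /\ exists x : V, p =i annihilator x].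

End AssociatedPrimes.

Definition weakly_laskerian (R : comNzRingType) (V : lmodType R) :=
  forall U : submodClosed V, finite_set (Ass (quotmod U)).

(* Main.v *)
From HB Require Import structures.
From Stdlib Require List.
Require Import Defs.
From mathcomp Require Import all_boot all_algebra.
From mathcomp Require Import mathcomp_extra boolp classical_sets functions.
From mathcomp Require Import cardinality.
From mathcomp Require Import freeg.

Set Implicit Arguments.
Unset Strict Implicit.
Unset Printing Implicit Defensive.

Import GRing.Theory.

Local Open Scope classical_set_scope.
Local Open Scope ring_scope.

(** For all but finitely many primes [p] containing [a], the ideal [a] is
    nilpotent at [p]: some [c] outside [p] satisfies [c a^k = 0]. Indeed some
    product of finitely many primes [q] is zero. If [a] lies in every such [q] below
    [p], clearing the other factors with elements outside [p] gives [c].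
    Otherwise some [q] below [p] does not contain [a], and since the dimension
    is at most two, [p] is [m] or minimal over [a + q]; an ideal of a Noetherian
    ring has finitely many minimal primes ([finite_nonnilpotent_locus]).

    Let [Y] be the [a]-torsion of [X], and let [c a^k0 = 0]. For [k >= k0] the
    projection [M -> M / a^k M] and the inclusion [Y -> X] are invertible up to
    [c], so the local cohomology maps to Ext(M, Y) with a kernel killed by
    [c^2]. If [c] is not in a prime [p], an element with annihilator [p] then
    has an image with annihilator [p]. So outside the finite exceptional set,
    the associated primes of the local cohomology are associated primes of
    Ext(M, Y). Working with this [c] replaces localisation, and with it the
    compatibility of Ext with localisation. Associated primes do contain [a],
    because every element is killed by a power of [a]
    ([local_cohomology_torsion]).

    Finally, [M] being finitely generated, Ext(M, Y) embeds in a quotient of a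
    finite power [Y^n], with [n] and the quotient depending only on [M], [Y] and
    the degree: a cocycle of the standard resolution is determined up to
    coboundary by its values on finitely many chains ([finite_detection]). A
    finite power of a weakly Laskerian module is weakly Laskerian
    ([weakly_laskerian_power]), so that quotient has finitely many associated
    primes. *)

(** * Submodules and spans *)

Section Bundling.
Variables (R : comNzRingType) (V W : lmodType R).

Definition bundle_submod (P : {pred V}) (hP : submod_closed P) :
    submodClosed V :=
  HB.pack (P : V -> bool) (GRing.isSubmodClosed.Build R V P hP).

Definition bundle_linear (f : V -> W) (hf : linear f) : {linear V -> W} :=
  HB.pack f (GRing.isLinear.Build R V W *:%R f hf).

End Bundling.

Section Spans.
Variables (R : comNzRingType) (V : lmodType R).
Implicit Types (U : submodClosed V) (s t : seq V) (P : V -> Prop).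

Lemma spanmod_ind (A : set V) P :
  P 0 -> (forall c x y, P x -> P y -> P (c *: x + y)) ->
  (forall x, A x -> P x) -> forall x, x \in spanmod A -> P x.
Proof.
move=> P0 PD PA x.
have cP : submod_closed [pred y : V | `[< P y >] ].
  split=> [|c y z /asboolP Py /asboolP Pz]; apply/asboolP => //.
  exact: PD.
move=> /(span_sub (U := bundle_submod cP)) xP.
by apply/asboolP/xP => y /PA Py; apply/asboolP.
Qed.

Lemma spanmod_cons v s x : x \in spanmod [set` v :: s] ->
  exists c, x - c *: v \in spanmod [set` s].
Proof.
elim/spanmod_ind: x / => [|c x y [d hd] [e he]|x /=].
- by exists 0; rewrite scale0r subr0 rpred0.
- exists (c * d + e).
  have -> : c *: x + y - (c * d + e) *: v = c *: (x - d *: v) + (y - e *: v).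
    by rewrite scalerDl -scalerA scalerBr opprD addrACA.
  by rewrite rpredD ?rpredZ.
- rewrite inE => /predU1P[->|sx]; last first.
    by exists 0; rewrite scale0r subr0 mem_span.
  by exists 1; rewrite scale1r subrr rpred0.
Qed.

Lemma spanmod_mono s t : {subset s <= t} ->
  {subset spanmod [set` s] <= spanmod [set` t]}.
Proof. by move=> st; apply: span_sub => x /= /st xt; apply: mem_span. Qed.

End Spans.

(** * Primes of a Noetherian ring *)

Section Ideals.
Variable R : comNzRingType.
Implicit Types (I J p q a m : {pred R}).

Lemma ideal0 I : ideal I -> 0 \in I. Proof. by case. Qed.

Lemma idealD I x y : ideal I -> x \in I -> y \in I -> x + y \in I.
Proof. by move=> hI xI yI; have := hI.2 1 x y xI yI; rewrite scale1r. Qed.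

Lemma ideal_mull I x y : ideal I -> y \in I -> x * y \in I.
Proof. by move=> hI yI; have := hI.2 x y 0 yI (ideal0 hI); rewrite addr0. Qed.

Lemma ideal_mulr I x y : ideal I -> x \in I -> x * y \in I.
Proof. by move=> hI xI; rewrite mulrC ideal_mull. Qed.

Lemma mk_ideal I : 0 \in I ->
  (forall c x y, x \in I -> y \in I -> c * x + y \in I) -> ideal I.
Proof. by []. Qed.

Lemma ideal_of_proper I : idealr_closed I -> ideal I.
Proof. by case=> I0 _ IM; split. Qed.

Lemma proper_of_ideal I : ideal I -> 1 \notin I -> idealr_closed I.
Proof. by move=> [I0 IM] I1; split. Qed.

Lemma prime_ideal_ideal p : prime_ideal p -> ideal p.
Proof. by case=> /ideal_of_proper. Qed.

Lemma prime1 p : prime_ideal p -> 1 \notin p. Proof. by case=> -[]. Qed.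

Lemma primeM p x y : prime_ideal p -> x * y \in p -> x \in p \/ y \in p.
Proof. by case=> _ /[apply] /orP. Qed.

Lemma primeX p x n : prime_ideal p -> x ^+ n \in p -> x \in p.
Proof.
move=> pp; elim: n => [|n IHn]; first by rewrite expr0 (negPf (prime1 pp)).
by rewrite exprS => /(primeM pp)[//|/IHn].
Qed.

Lemma ideal_span_sub I (A : set R) : ideal I -> (forall x, A x -> x \in I) ->
  {subset spanmod (V := R^o) A <= I}.
Proof.
move=> hI AI.
by apply: (span_sub (U := bundle_submod (hI : submod_closed (I : {pred R^o})))).
Qed.

Definition sum_ideal I J : {pred R} :=
  [pred z | `[< exists x y, [/\ x \in I, y \in J & z = x + y] >] ].

Lemma sum_ideal_ideal I J : ideal I -> ideal J -> ideal (sum_ideal I J).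
Proof.
move=> hI hJ; apply: mk_ideal.
  by apply/asboolP; exists 0, 0; rewrite !ideal0 ?addr0.
move=> c _ _ /asboolP[x [y [xI yJ ->]]] /asboolP[z [t [zI tJ ->]]].
apply/asboolP; exists (c * x + z), (c * y + t).
by split; rewrite ?idealD ?ideal_mull // mulrDr addrACA.
Qed.

Lemma sub_sum_ideall I J : ideal J -> {subset I <= sum_ideal I J}.
Proof.
by move=> hJ x xI; apply/asboolP; exists x, 0; rewrite ideal0 ?addr0.
Qed.

Lemma sub_sum_idealr I J : ideal I -> {subset J <= sum_ideal I J}.
Proof.
by move=> hI x xI; apply/asboolP; exists 0, x; rewrite ideal0 ?add0r.
Qed.

Definition principal (x : R) : {pred R} :=
  [pred z | `[< exists c, z = c * x >] ].

Lemma principal_ideal x : ideal (principal x).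
Proof.
apply: mk_ideal; first by apply/asboolP; exists 0; rewrite mul0r.
move=> c _ _ /asboolP[d ->] /asboolP[e ->]; apply/asboolP.
by exists (c * d + e); rewrite mulrDl mulrA.
Qed.

Hypothesis noethR : noetherian R.

(** If every ideal satisfying [P] could be enlarged within [P], iterating would
    give a strictly increasing sequence of ideals; its union is generated by
    finitely many elements, all of them already in one term of the sequence. *)
Lemma noetherian_maximal (P : {pred R} -> Prop) I0 :
    (forall I, P I -> ideal I) -> P I0 ->
  exists I, [/\ P I, {subset I0 <= I} &
    forall J, P J -> {subset I <= J} -> {subset J <= I}].
Proof.
move=> Pideal PI0; apply: contrapT => nomax.
pose T := {I : {pred R} | P I /\ {subset I0 <= I}}.
have step (I : T) : exists J : T,
    {subset sval I <= sval J} /\ ~ {subset sval J <= sval I}.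
  case: I => I [PI I0I] /=; apply: contrapT => noJ; apply: nomax.
  exists I; split=> // J PJ IJ; apply: contrapT => nJI; apply: noJ.
  by exists (exist _ J (conj PJ (fun x xI0 => IJ x (I0I x xI0)))).
have [next nextP] := choice step.
pose f n : T := iter n next (exist _ I0 (conj PI0 (fun _ => id))).
have fS n : {subset sval (f n) <= sval (f n.+1)} by have [] := nextP (f n).
have f_mono n k : (n <= k)%N -> {subset sval (f n) <= sval (f k)}.
  elim: k => [|k IHk]; first by rewrite leqn0 => /eqP ->.
  by rewrite leq_eqVlt => /predU1P[-> //|/IHk nk] x /nk; apply: fS.
have hf n : ideal (sval (f n)) by apply: Pideal; have [] := svalP (f n).
pose U : {pred R} := [pred x | `[< exists n, x \in sval (f n) >] ].
have hU : ideal U.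
  apply: mk_ideal; first by apply/asboolP; exists 0%N; exact: ideal0.
  move=> c x y /asboolP[k xk] /asboolP[l yl]; apply/asboolP.
  exists (maxn k l); rewrite idealD ?ideal_mull//.
    exact: f_mono (leq_maxl k l) _ xk.
  exact: f_mono (leq_maxr k l) _ yl.
have [s sU] := noethR hU.
have [n sn] : exists n, {subset s <= sval (f n)}.
  have : {subset s <= U}.
    by move=> x xs; rewrite sU; exact: (mem_span (V := R^o)).
  elim: s {sU} => [|x s IHs] sU; first by exists 0%N.
  have /asboolP[k xk] := sU x (mem_head _ _).
  have [|l sl] := IHs; first by move=> y ys; apply: sU; rewrite inE ys orbT.
  exists (maxn k l) => y; rewrite inE => /predU1P[->|/sl].
    exact: f_mono (leq_maxl k l) _ xk.
  exact: f_mono (leq_maxr k l) y.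
have [_] := nextP (f n); apply=> x xn1.
have xU : x \in U by apply/asboolP; exists n.+1.
by apply: (ideal_span_sub (hf n) sn); rewrite -sU.
Qed.

(** Encoded on elements: the products below generate the product ideal. *)
Definition product_sub (qs : seq {pred R}) I :=
  forall xs : seq R, all2 (fun (q : {pred R}) x => x \in q) qs xs ->
    \prod_(x <- xs) x \in I.

(** For a maximal counterexample [I], some product [x * y] is in [I] while [x]
    and [y] are not; the lists found for [I + (x)] and [I + (y)], put end to
    end, do for [I]. *)
Lemma noetherian_prime_product I : ideal I -> exists qs : seq {pred R},
  (forall q, List.In q qs -> prime_ideal q /\ {subset I <= q}) /\
  product_sub qs I.
Proof.
move=> hI0; apply: contrapT => bad0.
pose bad J := ideal J /\ ~ exists qs : seq {pred R},
  (forall q, List.In q qs -> prime_ideal q /\ {subset J <= q}) /\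
  product_sub qs J.
have [J [] //|//|{bad0 hI0}J [+ _ +]] := @noetherian_maximal bad I.
move: {I} J => I [hI badI] maxI.
have I1 : 1 \notin I.
  apply/negP => I1; apply: badI; exists [::]; split=> // xs _.
  by rewrite -[X in X \in I]mulr1 ideal_mull.
have good x : x \notin I -> exists qs : seq {pred R},
    (forall q, List.In q qs -> prime_ideal q /\ {subset I <= q}) /\
    product_sub qs (sum_ideal I (principal x)).
  move=> xI; apply: contrapT => badx.
  have hx : ideal (sum_ideal I (principal x)).
    exact: sum_ideal_ideal (principal_ideal x).
  move/negP: xI; apply; apply: (maxI (sum_ideal I (principal x))); last first.
  - by apply: sub_sum_idealr => //; apply/asboolP; exists 1; rewrite mul1r.
  - exact: sub_sum_ideall (principal_ideal x).
  - split=> // -[qs [primes_qs qsI]]; apply: badx; exists qs; split=> // q.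
    move=> /primes_qs[pq Iq]; split=> // z zI; apply: Iq.
    exact: sub_sum_ideall (principal_ideal x) _ zI.
have [x [y [xyI xI yI]]] :
    exists x y, [/\ x * y \in I, x \notin I & y \notin I].
  apply: contrapT => primeI; apply: badI; exists [:: I]; split; last first.
    by case=> [|x [|? ?]] //=; rewrite ?andbF // andbT big_seq1.
  move=> q [<-|//]; split=> //; split; first exact: proper_of_ideal.
  move=> x y xyI; apply/negPn/negP; rewrite negb_or => /andP[xI yI].
  by apply: primeI; exists x, y.
have [qs [pqs qsI]] := good x xI; have [rs [prs rsI]] := good y yI.
apply: badI; exists (qs ++ rs); split.
  by move=> q /(List.in_app_or qs rs)[/pqs|/prs].
move=> zs zsP.
have [zs1 [zs2 [-> zs1P zs2P]]] : exists zs1 zs2, [/\ zs = zs1 ++ zs2,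
    all2 (fun (q : {pred R}) x => x \in q) qs zs1 &
    all2 (fun (q : {pred R}) x => x \in q) rs zs2].
  elim: qs zs zsP {pqs qsI} => [|q qs IHqs] zs /=; first by exists [::], zs.
  case: zs => //= z zs /andP[zq /IHqs[zs1 [zs2 [-> zs1P zs2P]]]].
  by exists (z :: zs1), zs2; rewrite /= zq.
rewrite big_cat /=.
have /asboolP[u [_ [uI /asboolP[c ->] ->]]] := qsI _ zs1P.
have /asboolP[v [_ [vI /asboolP[d ->] ->]]] := rsI _ zs2P.
rewrite mulrDl; apply: idealD => //; first exact: ideal_mulr.
rewrite mulrDr; apply: idealD => //; first exact: ideal_mull.
by rewrite mulrACA; apply: ideal_mull.
Qed.

Lemma prime_product_sub p (qs : seq {pred R}) I :
    prime_ideal p -> product_sub qs I -> {subset I <= p} ->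
  exists2 q, List.In q qs & {subset q <= p}.
Proof.
move=> pp qsI Ip; apply: contrapT => noq.
have [xs [xsP xsp]] : exists xs : seq R,
    all2 (fun (q : {pred R}) x => x \in q) qs xs /\
    \prod_(x <- xs) x \notin p.
  elim: qs {qsI} noq => [|q qs IHqs] noq.
    by exists [::]; rewrite big_nil prime1.
  have [|xs [xsP xsp]] := IHqs.
    by case=> r rqs rp; apply: noq; exists r => //; right.
  have [x xq xp] : exists2 x, x \in q & x \notin p.
    apply: contrapT => nox; apply: noq; exists q; first by left.
    by move=> x xq; apply: contrapT => /negP xp; apply: nox; exists x.
  exists (x :: xs); rewrite /= xq xsP big_cons; split=> //.
  by apply/negP => /(primeM pp)[|]; apply/negP.
by move/negP: xsp; apply; apply/Ip/qsI.
Qed.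

Lemma idealX_sub_ideal a k J : ideal J ->
    (forall ys : seq R, size ys = k -> {subset ys <= a} ->
       \prod_(y <- ys) y \in J) ->
  {subset idealX a k <= J}.
Proof.
elim: k J => [|k IHk] J hJ aJ.
  move=> x _; rewrite -[x]mulr1; apply: ideal_mull => //.
  by have := aJ [::] erefl; rewrite big_nil; apply.
apply: ideal_span_sub => // _ [r ra [x xk <-]].
pose K : {pred R} := [pred z | r * z \in J].
have hK : ideal K.
  apply: mk_ideal; rewrite ?inE ?mulr0 ?ideal0// => c y z yK zK.
  by rewrite inE mulrDr mulrCA; apply: idealD => //; apply: ideal_mull.
apply: (IHk K hK _ x xk) => ys ysk ysa.
have := aJ (r :: ys); rewrite big_cons /= ysk; apply=> // y.
by rewrite inE => /predU1P[->|/ysa].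
Qed.

Lemma exp_idealX a x k : x \in a -> x ^+ k \in idealX a k.
Proof.
move=> xa; elim: k => [//|k IHk]; rewrite exprS; apply: mem_span.
by exists x => //; exists (x ^+ k).
Qed.

(** After localising at [p], the factors [q] not inside [p] become the unit
    ideal, so the product of the others vanishes; if these all contain [a], then
    [a] becomes nilpotent. *)
Lemma locally_nilpotent p a (qs : seq {pred R}) :
    prime_ideal p -> ideal a -> product_sub qs [pred z | z == 0] ->
    (forall q, List.In q qs -> {subset q <= p} -> {subset a <= q}) ->
  exists c k, c \notin p /\ forall r, r \in idealX a k -> c * r = 0.
Proof.
move=> pp ha qs0 aq.
have [c [k [cp ck]]] : exists c k, c \notin p /\
    forall ys : seq R, size ys = k -> {subset ys <= a} -> exists xs : seq R,
      all2 (fun (q : {pred R}) x => x \in q) qs xs /\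
      \prod_(x <- xs) x = c * \prod_(y <- ys) y.
  elim: qs aq {qs0} => [|q qs IHqs] aq.
    exists 1, 0%N; split=> [|ys /size0nil-> _]; first exact: prime1.
    by exists [::]; rewrite mul1r.
  have [|c [k [cp ck]]] := IHqs; first by move=> r rqs; apply: aq; right.
  have [qp|nqp] := pselect {subset q <= p}.
    exists c, k.+1; split=> // -[//|y ys] /= [ysk] ysa.
    have [|xs [xsP xsE]] := ck ys ysk.
      by move=> z zys; apply: ysa; rewrite inE zys orbT.
    exists (y :: xs); rewrite /= xsP big_cons xsE big_cons mulrCA; split=> //.
    by rewrite andbT (aq q _ qp) ?ysa ?mem_head//; left.
  have [x xq xp] : exists2 x, x \in q & x \notin p.
    apply: contrapT => nox; apply: nqp => x xq.
    by apply: contrapT => /negP xp; apply: nox; exists x.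
  exists (x * c), k; split; first by apply/negP => /(primeM pp)[]; apply/negP.
  move=> ys ysk ysa; have [xs [xsP xsE]] := ck ys ysk ysa.
  by exists (x :: xs); rewrite /= xq xsP big_cons xsE mulrA.
exists c, k; split=> // r rk.
pose J : {pred R} := [pred z | c * z == 0].
have hJ : ideal J.
  apply: mk_ideal; rewrite ?inE ?mulr0// => d x y; rewrite !inE.
  by move=> /eqP x0 /eqP y0; rewrite mulrDr mulrCA x0 y0 mulr0 addr0.
apply/eqP/(idealX_sub_ideal hJ _ rk) => ys ysk ysa; rewrite inE.
by have [xs [/qs0 + <-]] := ck ys ysk ysa.
Qed.

Lemma proper_sub_maximal I : ideal I -> 1 \notin I ->
  exists2 m, maximal_ideal m & {subset I <= m}.
Proof.
move=> hI I1.
have [J /ideal_of_proper //||m [pm Im maxm]] :=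
  @noetherian_maximal (@idealr_closed R) I.
  exact: proper_of_ideal.
exists m => //; split=> // J pJ mJ x; apply/idP/idP; last exact: mJ.
exact: maxm.
Qed.

Lemma maximal_prime m : maximal_ideal m -> prime_ideal m.
Proof.
move=> [pm maxm]; split=> // x y xym; have hm := ideal_of_proper pm.
apply/orP; have [xm|xm] := boolP (x \in m); [by left|right].
have hx : ideal (sum_ideal m (principal x)).
  exact: sum_ideal_ideal (principal_ideal x).
have xx : x \in sum_ideal m (principal x).
  by apply: sub_sum_idealr => //; apply/asboolP; exists 1; rewrite mul1r.
have [/asboolP[u [_ [um /asboolP[c ->] e1]]]|x1] :=
    boolP (1 \in sum_ideal m (principal x)).
  rewrite -[y]mul1r e1 mulrDl; apply: idealD => //; first exact: ideal_mulr.
  by rewrite -mulrA; apply: ideal_mull.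
have mx := sub_sum_ideall (principal_ideal x).
by move: xm; rewrite -(maxm _ (proper_of_ideal hx x1) (mx m)) xx.
Qed.

Lemma prime_sub_local m p : local_ring m -> prime_ideal p -> {subset p <= m}.
Proof.
move=> [_ uniqm] pp; have hp := prime_ideal_ideal pp.
have [m' /uniqm mm' pm'] := proper_sub_maximal hp (prime1 pp).
by move=> x /pm'; rewrite mm'.
Qed.

Lemma pred_eq p q : p =i q -> p = q.
Proof. by move=> pq; apply/funext => x; have := pq x; rewrite !unfold_in. Qed.

(** If [a] is not nilpotent at [p], there is a prime [q] below [p] with [a] not
    inside [q], taken from a finite list that multiplies to zero. A prime
    strictly between [a + q] and [p] would prolong to a chain of length three
    ending in [m]; hence [p] is minimal over [a + q], or is [m]. *)
Lemma finite_nonnilpotent_locus m a :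
    local_ring m -> krull_dim_le R 2 -> ideal a ->
  exists E : set {pred R}, finite_set E /\
    forall p, prime_ideal p -> {subset a <= p} -> E p \/
      exists c k, c \notin p /\ forall r, r \in idealX a k -> c * r = 0.
Proof.
move=> locm dim2 ha.
have h0 : ideal [pred z : R | z == 0].
  apply: mk_ideal => [|c x y]; rewrite !inE// => /eqP-> /eqP->.
  by rewrite mulr0 addr0.
have [qs [pqs qs0]] := noetherian_prime_product h0.
have minimal_over q : exists ps : seq {pred R}, prime_ideal q ->
    (forall p, List.In p ps -> prime_ideal p /\ {subset sum_ideal a q <= p}) /\
    product_sub ps (sum_ideal a q).
  have [pq|npq] := pselect (prime_ideal q); last by exists [::].
  have [ps psP] := noetherian_prime_product
    (sum_ideal_ideal ha (prime_ideal_ideal pq)).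
  by exists ps.
have [ps psP] := choice minimal_over.
(* the product of [ps q] is inside [a + q], so that [ps q] contains all primes
   minimal over [a + q] *)
pose L := m :: flatten [seq ps q | q <- qs].
exists [set p | List.In p L]; split.
  elim: L => [|p L IHL]; first by rewrite (_ : mkset _ = set0)// -subset0.
  rewrite (_ : mkset _ = [set p] `|` [set q | List.In q L]).
    by rewrite finite_setU.
  by apply/seteqP; split=> q /= [->|]; by [left|right].
move=> p pp ap.
have [aq|] := pselect
    (forall q, List.In q qs -> {subset q <= p} -> {subset a <= q}).
  by right; apply: locally_nilpotent pp ha qs0 aq.
move=> /existsNP[q /not_implyP[qqs /not_implyP[qp naq]]]; left.
have [pq _] := pqs q qqs; have hq := prime_ideal_ideal pq.
have [pm|npm] := pselect (p =i m); first by left; apply/esym/pred_eq.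
right; have [psq1 psq2] := psP q pq.
have [|p' p'q p'p] := prime_product_sub pp psq2.
  move=> _ /asboolP[x [y [/ap xp /qp yp ->]]].
  exact: idealD (prime_ideal_ideal pp) xp yp.
suff -> : p = p'.
  elim: qs qqs {L pqs qs0} => //= r qs IHqs [->|/IHqs]; rewrite List.in_app_iff.
    by left.
  by right.
have [pp' aqp'] := psq1 p' p'q.
apply/pred_eq => x; apply/idP/idP; last exact: p'p.
move: x; apply: contrapT => npp'.
pose chain := nth m [:: q; p'; p].
have : (3 <= 2)%N; last by [].
apply: (dim2 3 chain) => [[|[|[|[|i]]]] // _|[|[|[|i]]] // _].
- exact: maximal_prime locm.1.
- split; last first.
    move=> p'q_sub; apply: naq => x xa.
    exact/p'q_sub/aqp'/sub_sum_ideall.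
  by move=> x xq; apply/aqp'/sub_sum_idealr.
- split; first exact: prime_sub_local locm pp.
  move=> mp; apply: npm => x; apply/idP/idP; last exact: mp.
  exact: prime_sub_local locm pp x.
Qed.

End Ideals.

(** * Noetherian modules *)

(** Induction on [s]: the coefficients of the head of [s] in the elements of
    [U] form an ideal, and lifts to [U] of finitely many generators of it
    reduce an element of [U] to one in the span of the tail. *)
Lemma noetherian_capmod (R : comNzRingType) (V : lmodType R)
    (U : submodClosed V) (s : seq V) :
  noetherian R -> exists t : seq V,
    (forall x, x \in t -> x \in U /\ x \in spanmod [set` s]) /\
    forall x, x \in U -> x \in spanmod [set` s] -> x \in spanmod [set` t].
Proof.
move=> noethR; elim: s => [|v s [t [tU Ut]]].
  by exists [::]; split=> // x _.
pose I : {pred R} := [pred c | `[< exists2 y, y \in spanmod [set` s] &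
  c *: v + y \in U >] ].
have hI : ideal I.
  apply: mk_ideal.
    by apply/asboolP; exists 0; rewrite ?scale0r ?addr0 rpred0.
  move=> d c1 c2 /asboolP[y1 y1s U1] /asboolP[y2 y2s U2]; apply/asboolP.
  exists (d *: y1 + y2); first by rewrite rpredD ?rpredZ.
  have -> : (d * c1 + c2) *: v + (d *: y1 + y2)
          = d *: (c1 *: v + y1) + (c2 *: v + y2).
    by rewrite scalerDl -scalerA scalerDr addrACA.
  by rewrite rpredD ?rpredZ.
have [cs Ics] := noethR _ hI.
have [zs [zsU zsI]] : exists zs : seq V,
    (forall z, z \in zs -> z \in U /\ z \in spanmod [set` v :: s]) /\
    forall c, c \in I -> exists2 z,
      z \in spanmod [set` zs] & z - c *: v \in spanmod [set` s].
  have csI c : c \in cs -> c \in I by move=> ccs; rewrite Ics; apply: mem_span.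
  have [zs [zsU zscs]] : exists zs : seq V,
      (forall z, z \in zs -> z \in U /\ z \in spanmod [set` v :: s]) /\
      forall c, c \in cs -> exists2 z,
        z \in spanmod [set` zs] & z - c *: v \in spanmod [set` s].
    elim: cs csI {Ics} => [|c cs IHcs] csI; first by exists [::].
    have [|zs [zsU zscs]] := IHcs.
      by move=> d dcs; rewrite csI// inE dcs orbT.
    have /asboolP[y ys yU] := csI c (mem_head _ _).
    exists (c *: v + y :: zs); split=> [z|d].
      rewrite inE => /predU1P[->|/zsU//]; split=> //.
      apply: rpredD; first by rewrite rpredZ// mem_span//= mem_head.
      by apply: spanmod_mono ys => w ws; rewrite inE ws orbT.
    rewrite inE => /predU1P[->|/zscs[z zzs zd]].
      exists (c *: v + y); first by rewrite mem_span//= mem_head.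
      by rewrite addrAC subrr add0r.
    by exists z => //; apply: spanmod_mono zzs => w ws; rewrite inE ws orbT.
  exists zs; split=> // c; rewrite Ics; elim/spanmod_ind: c / => [|d c1 c2|//].
    by exists 0; rewrite ?rpred0// scale0r subr0 rpred0.
  move=> [z1 z1s e1] [z2 z2s e2]; exists (d *: z1 + z2).
    by rewrite rpredD ?rpredZ.
  have -> : d *: z1 + z2 - (d *: (c1 : R^o) + c2) *: v
          = d *: (z1 - c1 *: v) + (z2 - c2 *: v).
    by rewrite scalerDl -scalerA scalerBr opprD addrACA.
  by rewrite rpredD ?rpredZ.
exists (zs ++ t); split=> [x|x xU xvs].
  rewrite mem_cat => /orP[/zsU//|/tU[xU xs]]; split=> //.
  by apply: spanmod_mono xs => w ws; rewrite inE ws orbT.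
have [c xc] := spanmod_cons xvs.
have [|z zzs zc] := zsI c.
  by apply/asboolP; exists (x - c *: v) => //; rewrite addrC subrK.
have zU : z \in U by apply: span_sub zzs => y /zsU[].
rewrite -[x](subrK z) rpredD//; last first.
  by apply: spanmod_mono zzs => w ws; rewrite mem_cat ws.
apply: (@spanmod_mono _ _ t) => [w wt|]; first by rewrite mem_cat wt orbT.
apply: Ut; first by rewrite -scaleN1r rpredD ?rpredZ.
have -> : x - z = (x - c *: v) + (-1) *: (z - c *: v).
  by rewrite scaleN1r opprB addrA subrK.
by rewrite rpredD ?rpredZ.
Qed.

Section Linear.
Variables (R : comNzRingType) (V W : lmodType R).

Lemma linear_span_eq0 (f : {linear V -> W}) (A : set V) :
  (forall x, A x -> f x = 0) -> forall x, x \in spanmod A -> f x = 0.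
Proof.
move=> fA x; elim/spanmod_ind: x / => [|c x y fx fy|//]; first exact: linear0.
by rewrite linearP fx fy scaler0 addr0.
Qed.

Lemma quot_lift_ex (U : submodClosed V) (f : {linear V -> W}) :
  (forall x, x \in U -> f x = 0) ->
  exists g : {linear quotmod U -> W}, forall x, g (to_quot U x) = f x.
Proof.
move=> fU; pose g (q : quotmod U) := f (repr q).
have gE x : g (to_quot U x) = f x.
  by apply/eqP; rewrite -subr_eq0 -linearB fU//; apply/to_quotP/to_quotK.
have lg : linear g.
  move=> c q r; rewrite -[q]to_quotK -[r]to_quotK -linearP !gE.
  by rewrite linearP.
by exists (bundle_linear lg).
Qed.

End Linear.

Lemma to_quotZ (R : comNzRingType) (V : lmodType R) (U : submodClosed V) c x :
  to_quot U (c *: x) = c *: to_quot U x.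
Proof. exact: linearZ. Qed.

(** * Associated primes and weakly Laskerian modules *)

Section AssociatedPrimes.
Variable R : comNzRingType.
Implicit Types (V W : lmodType R) (p : {pred R}).

Lemma Ass_quotP V (U : submodClosed V) p : Ass (quotmod U) p <->
  prime_ideal p /\ exists x, forall r, (r \in p) = (r *: x \in U).
Proof.
have U0 x r : (r *: to_quot U x == 0) = (r *: x \in U).
  rewrite -linearZ -(linear0 (to_quot U)); apply/eqP/idP.
    by move=> /to_quotP; rewrite subr0.
  by move=> rx; apply/to_quotP; rewrite subr0.
split=> -[pp [x px]]; split=> //.
  by exists (repr x) => r; rewrite px inE -U0 to_quotK.
by exists (to_quot U x) => r; rewrite px inE U0.
Qed.

(** If the annihilator of [x] is the prime [p], then so is that of [c *: x] for
    [c] outside [p]; hence a kernel killed by [c] cannot enlarge it. *)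
Lemma Ass_transfer V W (f : {linear V -> W}) p c :
  c \notin p -> (forall x, f x = 0 -> c *: x = 0) -> Ass V p -> Ass W p.
Proof.
move=> cp kerf [pp [x px]]; split=> //; exists (f x) => r.
apply/idP/eqP => [|rfx].
  by rewrite px inE => /eqP rx; rewrite -linearZ rx linear0.
have /kerf : f (r *: x) = 0 by rewrite linearZ.
rewrite scalerA => /eqP crx; have : c * r \in p by rewrite px inE.
by move=> /(primeM pp)[|//]; rewrite (negPf cp).
Qed.

(** Suppose [p] is the annihilator of the class of [f x + g y]. If some
    multiple by an [r] outside [p] comes from the image of [f], that multiple
    still has annihilator [p]; otherwise [p] is the annihilator of the class
    of [g y] modulo the image of [f]. So [p] is an associated prime of a quotient
    of [V1] or of [V2]. *)
Lemma weakly_laskerian_sum V1 V2 W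
    (f : {linear V1 -> W}) (g : {linear V2 -> W}) :
    (forall w, exists x y, w = f x + g y) ->
  weakly_laskerian V1 -> weakly_laskerian V2 -> weakly_laskerian W.
Proof.
move=> fg wl1 wl2 U.
have cU1 : submod_closed [pred x | f x \in U].
  split=> [|c x y]; rewrite !inE ?linear0 ?rpred0// linearP => xU yU.
  by rewrite rpredD ?rpredZ.
have cU2 : submod_closed [pred y | `[< exists x, g y + f x \in U >] ].
  split; first by apply/asboolP; exists 0; rewrite !linear0 addr0 rpred0.
  move=> c y z /asboolP[x xy] /asboolP[t tz]; apply/asboolP.
  exists (c *: x + t); rewrite !linearP addrACA -scalerDr.
  by rewrite rpredD ?rpredZ.
have fin1 := wl1 (bundle_submod cU1); have fin2 := wl2 (bundle_submod cU2).
apply: (@sub_finite_set _ _ (Ass (quotmod (bundle_submod cU1)) `|`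
  Ass (quotmod (bundle_submod cU2)))); last by rewrite finite_setU.
move=> p /Ass_quotP[pp [w pw]].
have [[r [x [rp rx]]]|nor] := pselect
    (exists r x, r \notin p /\ r *: w - f x \in U).
  left; apply/Ass_quotP; split=> //; exists x => s.
  have -> : (s *: x \in bundle_submod cU1) = (f (s *: x) \in U) by [].
  have srx : s *: (r *: w - f x) \in U by rewrite rpredZ.
  apply/idP/idP => [sp|sxU].
    have srw : r *: (s *: w) \in U by rewrite rpredZ// -pw.
    have -> : f (s *: x) = r *: (s *: w) + (-1) *: (s *: (r *: w - f x)).
      rewrite linearZ scalerBr scaleN1r opprB addrC.
      by rewrite !scalerA (mulrC r) subrK.
    by apply: rpredD => //; exact: rpredZ.
  have : s * r \in p.
    rewrite pw -scalerA -[r *: w](subrK (f x)) scalerDr -linearZ.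
    by rewrite rpredD.
  by move=> /(primeM pp)[//|]; rewrite (negPf rp).
right; apply/Ass_quotP; split=> //.
have [x [y wE]] := fg w; exists y => r.
have -> : (r *: y \in bundle_submod cU2)
        = `[< exists x, g (r *: y) + f x \in U >] by [].
apply/idP/asboolP => [|[z zU]].
  rewrite pw => rw; exists (r *: x).
  by rewrite !linearZ -scalerDr addrC -wE.
apply: contrapT => /negP rp; apply: nor; exists r, (r *: x - z); split=> //.
rewrite wE scalerDr -!linearZ linearB opprB (addrC (f (r *: x))) -addrA.
by rewrite (addrC (f (r *: x))) subrK.
Qed.

Lemma weakly_laskerian_power V n :
  weakly_laskerian V -> weakly_laskerian ('I_n -> V).
Proof.
move=> wlV; elim: n => [|n IHn].
  move=> U; rewrite (_ : Ass _ = set0)// -subset0 => p /Ass_quotP[pp [x px]].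
  have /negP[] := prime1 pp; rewrite px (_ : 1 *: x = 0) ?rpred0//.
  by apply/funext => -[].
pose f (w : 'I_n -> V) : 'I_n.+1 -> V :=
  fun j => if unlift ord0 j is Some j' then w j' else 0.
pose g (v : V) : 'I_n.+1 -> V := fun j => if j == ord0 then v else 0.
have lf : linear f.
  move=> c v w; apply/funext => j.
  rewrite -[RHS]/(c *: f v j + f w j) /f; case: unliftP => [j' _|_] //.
  by rewrite scaler0 addr0.
have lg : linear g.
  move=> c v w; apply/funext => j.
  rewrite -[RHS]/(c *: g v j + g w j) /g; case: ifP => // _.
  by rewrite scaler0 addr0.
have sum_fg := weakly_laskerian_sum (f := bundle_linear lf)
  (g := bundle_linear lg).
apply: sum_fg => // w.
exists (w \o fintype.lift ord0), (w ord0); apply/funext => j.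
rewrite -[RHS]/(f (w \o fintype.lift ord0) j + g (w ord0) j) /f /g.
case: unliftP => [j' ->|->]; last by rewrite eqxx add0r.
by rewrite eq_sym (negPf (neq_lift _ _)) addr0.
Qed.

End AssociatedPrimes.

(** * Direct limits of sequences *)

Section DirectLimits.
Variables (R : comNzRingType) (A : nat -> lmodType R).
Variable t : forall k, {linear A k -> A k.+1}.

Lemma dsum_inE k (x : A k) : val (dsum_in x) k = x.
Proof. exact: dfwithin. Qed.

Lemma dsum_in_neq k (x : A k) l : k != l -> val (dsum_in x) l = 0.
Proof. by move=> kl; rewrite /= dfwithout. Qed.

Lemma dsum_in_is_linear k : linear (@dsum_in R A k).
Proof.
move=> c x y; apply: val_inj; apply/functional_extensionality_dep => l.
rewrite -[RHS]/(c *: val (dsum_in x) l + val (dsum_in y) l).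
have [<-|kl] := eqVneq k l; first by rewrite !dsum_inE.
by rewrite !dsum_in_neq// scaler0 addr0.
Qed.

HB.instance Definition _ k :=
  GRing.isLinear.Build R (A k) (dsum A) *:%R (@dsum_in R A k)
    (@dsum_in_is_linear k).

Definition to_limit k : A k -> direct_limit t := fun x => to_quot _ (dsum_in x).

Fact to_limit_is_linear k : linear (@to_limit k).
Proof. by move=> c x y; rewrite /to_limit !linearP. Qed.

HB.instance Definition _ k :=
  GRing.isLinear.Build R (A k) (direct_limit t) *:%R (@to_limit k)
    (@to_limit_is_linear k).

Lemma to_limitZ k r (x : A k) : to_limit (r *: x) = r *: to_limit x.
Proof. exact: linearZ. Qed.

Lemma to_limit_trans k (x : A k) : to_limit (t k x) = to_limit x.
Proof. by apply/esym/to_quotP; apply: mem_span; exists k, x. Qed.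

Lemma to_limit_leq k l (x : A k) :
  (k <= l)%N -> exists y : A l, to_limit y = to_limit x.
Proof.
elim: l => [|l IHl] kl.
  by move: kl x; rewrite leqn0 => /eqP -> x; exists x.
move: kl; rewrite leq_eqVlt => /predU1P[<-|/IHl[y <-]]; first by exists x.
by exists (t l y); rewrite to_limit_trans.
Qed.

(** Representatives exist at arbitrarily late stages, in particular beyond any
    stage from which a property of the system starts to hold. *)
Lemma to_limit_surj (z : direct_limit t) k0 :
  exists k (x : A k), (k0 <= k)%N /\ z = to_limit x.
Proof.
suff [n nz] : exists n, forall k, (n <= k)%N -> exists x : A k, z = to_limit x.
  exists (maxn n k0); have [x zx] := nz _ (leq_maxl n k0).
  by exists x; rewrite leq_maxr.
rewrite -[z]to_quotK; move: (repr z) => {z} d.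
have /asboolP[n dn] := valP d; exists n => k nk.
elim: n d dn nk => [|n IHn] d dn nk.
  exists 0; rewrite linear0 (_ : d = 0) ?linear0//.
  by apply: val_inj; apply/functional_extensionality_dep => l; apply: dn.
have [x xE] := to_limit_leq (val d n) (ltnW nk).
have [||y yE] := IHn (d - dsum_in (val d n)); last 2 first.
- exact: ltnW.
- exists (y + x); have -> : to_limit (y + x) = to_limit y + to_limit x.
    exact: linearD.
  by rewrite -yE xE -linearD subrK.
move=> l nl; rewrite -[LHS]/(val d l - val (dsum_in (val d n)) l).
have [<-|neq_nl] := eqVneq n l; first by rewrite dsum_inE subrr.
by rewrite dsum_in_neq// subr0 dn// ltn_neqAle neq_nl.
Qed.

Lemma direct_limit_lift (W : lmodType R) (phi : forall k, {linear A k -> W}) :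
    (forall k x, phi k.+1 (t k x) = phi k x) ->
  exists f : {linear direct_limit t -> W}, forall k (x : A k),
    f (to_limit x) = phi k x.
Proof.
move=> phi_t.
pose partial (d : dsum A) n := \sum_(k < n) phi k (val d k).
(* the sums over a finitely supported family are eventually constant *)
have /choice[F FE] : forall d, exists w,
    exists n0, forall n, (n0 <= n)%N -> partial d n = w.
  move=> d; have /asboolP[n dn] := valP d; exists (partial d n), n => l nl.
  rewrite -(subnKC nl) /partial big_split_ord /=.
  rewrite [X in _ + X]big1 ?addr0// => j _.
  by rewrite dn ?leq_addr// linear0.
have Funiq d w n0 : (forall n, (n0 <= n)%N -> partial d n = w) -> F d = w.
  move=> dw; have [n1 dF] := FE d.
  by rewrite -(dF _ (leq_maxr n0 n1)) dw// leq_maxl.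
have lF : linear F.
  move=> c d e; have [m dF] := FE d; have [n eF] := FE e.
  apply: (Funiq _ _ (maxn m n)) => l; rewrite geq_max => /andP[ml nl].
  rewrite -(dF l)// -(eF l)// /partial scaler_sumr -big_split /=.
  by apply: eq_bigr => k _; rewrite -linearP.
have F_in k (x : A k) : F (dsum_in x) = phi k x.
  apply: (Funiq _ _ k.+1) => n kn; rewrite /partial.
  rewrite (bigD1 (Ordinal kn))//= dfwithin big1 ?addr0// => j jk.
  rewrite dfwithout ?linear0//; apply: contraNneq jk => kj.
  by apply/eqP/val_inj.
have Frel x : x \in spanmod [set d : dsum A |
    exists k (x : A k), d = dsum_in x - dsum_in (t k x)] -> F x = 0.
  apply: (@linear_span_eq0 _ _ _ (bundle_linear lF)) => _ [k [y ->]].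
  by rewrite linearB /= !F_in phi_t subrr.
have [f fE] := @quot_lift_ex _ _ _ _ (bundle_linear lF) Frel.
by exists f => k x; rewrite /to_limit fE /= F_in.
Qed.

End DirectLimits.

(** * Cocycles on the standard resolution *)

Section FreeModules.
Variable R : comNzRingType.
Implicit Types N V W : lmodType R.

Lemma free_linear_eq N W (f g : {linear free_mod N -> W}) :
  (forall x : N, f << x >> = g << x >>) -> f =1 g.
Proof.
move=> fg D.
have -> : D = \sum_(x <- dom D) coeff x D *: (<< x >> : free_mod N).
  rewrite -[LHS]freeg_sumE; apply: eq_bigr => x _.
  by apply/eqP/freeg_eqP => y; rewrite coeffZ !coeffU mul1r.
by rewrite !linear_sum; apply: eq_bigr => x _; rewrite !linearZ /= fg.
Qed.

Lemma free_lift_ex N V W (f : {linear free_mod N -> W}) (g : {linear V -> W}) :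
  (forall x, exists y, g y = f x) ->
  exists s : {linear free_mod N -> V}, forall x, g (s x) = f x.
Proof.
move=> fg.
have /choice[s sE] : forall x : N, exists y, g y = f << x >>.
  by move=> x; apply: fg.
exists (free_lift s).
apply: (@free_linear_eq _ _ (g \o free_lift s) f) => x.
by rewrite /= free_liftU scale1r sE.
Qed.

Lemma res_diff2 n N x : res_diff n N (res_diff n.+1 N x) = 0.
Proof. by apply/res_exact; exists x. Qed.

Lemma free_map_comp N1 N2 N3 (f : {linear N1 -> N2}) (g : {linear N2 -> N3}) x :
  free_map g (free_map f x) = free_map (g \o f) x.
Proof.
apply: (@free_linear_eq _ _ (free_map g \o free_map f) (free_map (g \o f))).
by move=> y; rewrite /= !free_liftU !scale1r free_liftU scale1r.
Qed.

Lemma eq_free_map N N' (f g : N -> N') : f =1 g -> free_map f =1 free_map g.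
Proof. by move=> /funext ->. Qed.

Lemma syz_map_comp n N1 N2 N3
    (f : {linear N1 -> N2}) (g : {linear N2 -> N3}) x :
  syz_map n g (syz_map n f x) = syz_map n (g \o f) x.
Proof.
elim: n x => [//|n IHn] x; apply: val_inj.
rewrite /= free_map_comp; apply: eq_free_map => y; exact: IHn.
Qed.

Lemma eq_syz_map n N N' (f g : {linear N -> N'}) :
  f =1 g -> syz_map n f =1 syz_map n g.
Proof.
move=> fg; elim: n => [//|n IHn] x; apply: val_inj.
exact: eq_free_map.
Qed.

Lemma res_map_comp n N1 N2 N3
    (f : {linear N1 -> N2}) (g : {linear N2 -> N3}) x :
  res_map n g (res_map n f x) = res_map n (g \o f) x.
Proof.
rewrite /res_map free_map_comp; apply: eq_free_map; exact: syz_map_comp.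
Qed.

Lemma eq_res_map n N N' (f g : {linear N -> N'}) :
  f =1 g -> res_map n f =1 res_map n g.
Proof. by move=> fg; apply: eq_free_map; apply: eq_syz_map. Qed.

End FreeModules.

Section Cocycles.
Variables (R : comNzRingType) (n : nat).
Implicit Types N V W : lmodType R.

Definition is_cocycle N V (h : res n N -> V) :=
  linear h /\ forall x, h (res_diff n N x) = 0.

Lemma eq_coboundary N V (g h : res n N -> V) :
  g =1 h -> is_coboundary n N V g -> is_coboundary n N V h.
Proof. by move=> /funext ->. Qed.

Lemma coboundary0 N V : is_coboundary n N V (fun=> 0).
Proof. by case: n => [|j] //=; exists \0. Qed.

Lemma coboundaryD N V c (g h : res n N -> V) :
  is_coboundary n N V g -> is_coboundary n N V h ->
  is_coboundary n N V (fun x => c *: g x + h x).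
Proof.
case: n g h => [|j] g h /=.
  by move=> g0 h0 x; rewrite g0 h0 scaler0 addr0.
by move=> [g' gE] [h' hE]; exists ((c \*: g') \+ h') => x; rewrite gE hE.
Qed.

Lemma coboundary_comp N V W (f : {linear V -> W}) (h : res n N -> V) :
  is_coboundary n N V h -> is_coboundary n N W (f \o h).
Proof.
case: n h => [|j] h /=; first by move=> h0 x; rewrite h0 linear0.
by move=> [g hE]; exists (f \o g) => x; rewrite hE.
Qed.

Lemma coboundary_res_map N N' V (f : {linear N -> N'}) (h : res n N' -> V) :
  is_coboundary n N' V h -> is_coboundary n N V (h \o res_map n f).
Proof.
case: n h => [|j] h /=; first by move=> h0 x; apply: h0.
move=> [g hE]; exists (g \o res_map j f) => x.
by rewrite /= hE; congr (g _); exact: res_diff_map.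
Qed.

Lemma coboundary_diff N V (h : res n N -> V) :
  is_coboundary n N V h -> forall x, h (res_diff n N x) = 0.
Proof.
case: n h => [|j] h /=; first by move=> h0 x; apply: h0.
by move=> [g hE] x; rewrite hE -[RHS](linear0 g); congr (g _); exact: res_diff2.
Qed.

Lemma coboundary_linear N V (h : res n N -> V) :
  is_coboundary n N V h -> linear h.
Proof.
case: n h => [|j] h /=; first by move=> h0 c x y; rewrite !h0 scaler0 addr0.
move=> [g /funext ->]; exact: (linearP (g \o res_diff j N)).
Qed.

Lemma cocycle_comp N V W (f : {linear V -> W}) (h : res n N -> V) :
  is_cocycle h -> is_cocycle (f \o h).
Proof.
move=> [lh h0]; split=> [c x y|x] /=; first by rewrite lh linearP.
by rewrite h0 linear0.
Qed.

Lemma cocycle_res_map N N' V (f : {linear N -> N'}) (h : res n N' -> V) :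
  is_cocycle h -> is_cocycle (h \o res_map n f).
Proof.
move=> [lh h0]; split=> [c x y|x] /=; first by rewrite linearP lh.
by rewrite -[RHS](h0 (res_map n.+1 f x)); congr (h _); exact/esym/res_diff_map.
Qed.

End Cocycles.

(** The comparison theorem for the zero map: the homotopy is built degree by
    degree from the freeness of the modules of the resolution. *)
Lemma chain_map_null (R : comNzRingType) (N N' : lmodType R)
    (u : forall n, {linear res n N -> res n N'}) :
    (forall n x, res_diff n N' (u n.+1 x) = u n (res_diff n N x)) ->
    (forall x, free_aug N' (u 0 x) = 0) ->
  forall n (V : lmodType R) (h : res n N' -> V), is_cocycle h ->
    is_coboundary n N V (h \o u n).
Proof.
move=> ud u0 n V h [lh h0].
suff [s us] : exists s : {linear res n N -> res n.+1 N'},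
    is_coboundary n N (res n N') (fun x => u n x - res_diff n N' (s x)).
  apply: eq_coboundary (coboundary_comp (bundle_linear lh) us) => x /=.
  by rewrite -[LHS]/(bundle_linear lh _) linearB /= h0 subr0.
elim: n {V h lh h0} => [|n [s us]].
  have [|s us] := @free_lift_ex _ _ _ _ (u 0) (res_diff 0 N').
    by move=> x; have /res_exact0[y ->] := u0 x; exists y.
  by exists s => x; rewrite us subrr.
pose v : {linear res n.+1 N -> res n.+1 N'} := u n.+1 \- (s \o res_diff n N).
have [|s' vs] := @free_lift_ex _ _ _ _ v (res_diff n.+1 N').
  move=> x; have /res_exact[y vy] : res_diff n N' (v x) = 0.
    rewrite /v /= linearB /= -(coboundary_diff us x).
    by congr (_ - _); exact: ud.
  by exists y.
exists s'; exists s => x; rewrite vs.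
by rewrite -[v x]/(u n.+1 x - s (res_diff n N x)) opprB addrC subrK.
Qed.

Section ScalarsOnExt.
Variables (R : comNzRingType) (n : nat) (N V : lmodType R) (c : R).
Variable h : res n N -> V.
Hypothesis cocycle_h : is_cocycle h.

(** The functorial map induced by a scalar is not literally that scalar, since
    the resolution is free on the underlying sets; it agrees with it up to
    homotopy. *)
Lemma cocycle_scale_map (f : {linear N -> N}) : (forall x, f x = c *: x) ->
  is_coboundary n N V (fun x => h (res_map n f x) - c *: h x).
Proof.
move=> fE.
pose u j : {linear res j N -> res j N} := res_map j f \- (c \*: idfun).
have uE j x : u j x = res_map j f x - c *: x by [].
apply: eq_coboundary (@chain_map_null _ _ _ u _ _ n V h cocycle_h).
- move=> x; rewrite -[LHS]/(bundle_linear cocycle_h.1 (u n x)) uE.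
  by rewrite linearB linearZ.
- move=> j x; rewrite !uE linearB linearZ.
  by congr (_ - _); exact: res_diff_map.
- by move=> x; rewrite uE linearB linearZ free_mapE fE subrr.
Qed.

Lemma cocycle_scale_annihilator : (forall x : N, c *: x = 0) ->
  is_coboundary n N V (fun x => c *: h x).
Proof.
move=> cN.
pose u j : {linear res j N -> res j N} := c \*: idfun.
have uE j x : u j x = c *: x by [].
apply: eq_coboundary (@chain_map_null _ _ _ u _ _ n V h cocycle_h).
- by move=> x; rewrite -[LHS]/(bundle_linear cocycle_h.1 (u n x)) uE linearZ.
- by move=> j x; rewrite !uE linearZ.
- by move=> x; rewrite uE linearZ; apply: cN.
Qed.

End ScalarsOnExt.

(** This is the finiteness of Ext for a finitely generated module, read off the
    standard resolution: a cocycle is determined up to coboundary by its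
    values on finitely many chains. In the step from degree [n] to [n + 1], let
    [S] be the chains for [n]. The projection [q] of [res n M] modulo
    [S] and boundaries is a cocycle vanishing on [S], hence a coboundary;
    lifting it, one finds an endomorphism [u] of [res n M] fixing boundaries and
    taking values in [<S>] + boundaries. For a cocycle [h] in degree [n + 1]
    that vanishes on chains whose boundaries generate the boundaries in [<S>],
    the recipe [d w |-> h w], [<S> |-> 0] is well defined, and composed with [u]
    it exhibits [h] as a coboundary. *)
Lemma finite_detection (R : comNzRingType) (M : lmodType R) n :
    noetherian R -> finitely_generated M ->
  exists s : seq (res n M), forall (V : lmodType R) (h : res n M -> V),
    is_cocycle h -> (forall x, x \in s -> h x = 0) -> is_coboundary n M V h.
Proof.
move=> noethR [gens gensM]; elim: n => [|n [s sP]].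
  (* in degree 0 the lifts of generators of [M] detect cocycles *)
  exists [seq << x >> : res 0 M | x <- gens] => V h [lh h0] hs x.
  have [y ys xy] : exists2 y : res 0 M,
      h y = 0 & free_aug M (x - y) = 0.
    have : free_aug M x \in spanmod [set` gens] by apply: gensM.
    move: (free_aug M x) (fun y => linearB (free_aug M) x y) => z.
    suff : z \in spanmod [set` gens] -> exists2 y : res 0 M,
      h y = 0 & free_aug M y = z.
      move=> ex augB /ex[y hy yz]; exists y => //.
      by rewrite augB yz subrr.
    elim/spanmod_ind: z / => [|c z1 z2 [y1 h1 e1] [y2 h2 e2]|z /= zg].
    - exists 0; rewrite ?linear0//.
      exact: (linear0 (bundle_linear lh)).
    - exists (c *: y1 + y2); last by rewrite linearP e1 e2.
      by rewrite lh h1 h2 scaler0 addr0.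
    - exists << z >>; last by rewrite /= free_liftU scale1r.
      by apply: hs; apply/map_f.
  have /res_exact0[w wE] := xy.
  rewrite -[x](subrK y) -[x - y]scale1r lh ys wE.
  by rewrite h0 scaler0 addr0.
(* the submodule [<S>] + boundaries, and the projection modulo it *)
pose L : {pred res n M} := [pred x | `[< exists w,
  x - res_diff n M w \in spanmod [set` s] >] ].
have cL : submod_closed L.
  split; first by apply/asboolP; exists 0; rewrite linear0 subr0 rpred0.
  move=> c x y /asboolP[w xw] /asboolP[z yz]; apply/asboolP.
  exists (c *: w + z); rewrite linearP opprD addrACA -scalerBr.
  by rewrite rpredD ?rpredZ.
pose q : {linear res n M -> quotmod (bundle_submod cL)} := to_quot _.
have LP x : q x = 0 <-> exists w, x - res_diff n M w \in spanmod [set` s].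
  rewrite -(linear0 q); split=> [/to_quotP|[w xw]].
    by rewrite subr0 => /asboolP.
  by apply/to_quotP; rewrite subr0; apply/asboolP; exists w.
have [u uL ud] : exists2 u : {linear res n M -> res n M},
    (forall x, q (u x) = 0) &
    forall w, u (res_diff n M w) = res_diff n M w.
  have : is_coboundary n M _ q.
    apply: sP => [|x xs]; first split=> [c x y|x]; first exact: linearP.
      by apply/LP; exists x; rewrite subrr rpred0.
    by apply/LP; exists 0; rewrite linear0 subr0 mem_span.
  move: (bundle_submod cL) @q {LP} => L' q.
  case: n {s sP L cL} L' @q => [|j] L' q; first by move=> q0; exists idfun.
  move=> [t qt]; have [|t' t'E] := @free_lift_ex _ _ _ _ t q.
    by move=> x; exists (repr (t x)); apply: to_quotK.
  pose u : {linear res j.+1 M -> res j.+1 M} := idfun \- (t' \o res_diff j M).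
  have uE x : u x = x - t' (res_diff j M x) by [].
  exists u => [x|w]; rewrite uE; last by rewrite res_diff2 linear0 subr0.
  by rewrite linearB t'E; apply/eqP; rewrite subr_eq0; apply/eqP/qt.
(* finitely many generators [bs] of the boundaries in [<S>], and chains [ws]
   with these boundaries, on which cocycles will be tested *)
have cB : submod_closed [pred x | `[< exists w, x = res_diff n M w >] ].
  split; first by apply/asboolP; exists 0; rewrite linear0.
  move=> c _ _ /asboolP[w ->] /asboolP[z ->]; apply/asboolP.
  by exists (c *: w + z); rewrite linearP.
have [bs [bsB Bbs]] := noetherian_capmod (bundle_submod cB) s noethR.
have [ws wsE] : exists ws : seq (res n.+1 M), bs = map (res_diff n M) ws.
  have : forall b, b \in bs -> exists w, b = res_diff n M w.
    by move=> b /bsB[/asboolP].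
  elim: bs {bsB Bbs} => [|b bs IHbs] bsB; first by exists [::].
  have [|ws ->] := IHbs.
    by move=> z zbs; apply: bsB; rewrite inE zbs orbT.
  by have [w ->] := bsB b (mem_head _ _); exists (w :: ws).
exists ws => V h [lh h0] hws.
have h_ker w : res_diff n M w \in spanmod [set` s] -> h w = 0.
  move=> dws; have : res_diff n M w \in spanmod [set` bs].
    by apply: Bbs => //; apply/asboolP; exists w.
  rewrite wsE => dw.
  have [w' hw' dw'] : exists2 w', h w' = 0 & res_diff n M w' = res_diff n M w.
    elim/spanmod_ind: (res_diff n M w) / dw =>
      [|c _ _ [y hy <-] [z hz <-]|_ /mapP[z zws ->]].
    - exists 0; rewrite ?linear0//; exact: (linear0 (bundle_linear lh)).
    - by exists (c *: y + z); rewrite ?linearP// lh hy hz scaler0 addr0.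
    - by exists z => //; apply: hws.
  have /res_exact[z zE] : res_diff n M (w - w') = 0.
    by rewrite linearB dw' subrr.
  rewrite -[w](subrK w') -[w - w']scale1r lh zE h0 hw' scaler0 addr0.
  by [].
have /choice[g gP] : forall x, exists w,
    u x - res_diff n M w \in spanmod [set` s].
  by move=> x; apply/LP.
(* by [h_ker] the value [h (g x)] depends only on [x] *)
have hg x w : u x - res_diff n M w \in spanmod [set` s] -> h (g x) = h w.
  move=> xw; apply/eqP; rewrite -subr_eq0.
  rewrite -(linearB (bundle_linear lh)) /= h_ker// linearB.
  rewrite (_ : _ - _ =
    (u x - res_diff n M w) + (-1) *: (u x - res_diff n M (g x))).
    by rewrite rpredD ?rpredZ ?gP.
  by rewrite scaleN1r opprB [RHS]addrC addrA subrK.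
have lhg : linear (h \o g).
  move=> c x y; rewrite /= -lh; apply: hg.
  rewrite (linearP u) (linearP (res_diff n M)) opprD addrACA -scalerBr.
  by apply: rpredD => //; exact: rpredZ.
exists (bundle_linear lhg) => w /=; apply/esym/hg.
by rewrite ud subrr rpred0.
Qed.

(** * Generalized local cohomology *)

Section LocalCohomology.
Variables (R : comNzRingType) (a : {pred R}) (M X : lmodType R) (i : nat).

Local Notation Q k := (quotmod (@powM R a M k) : lmodType R).
Local Notation Y := (submod (torsion a X)).
Local Notation H := (gen_local_cohomology a M X i).

Lemma Ext_eq0 N (u : submod (cocycle i N X)) :
  to_quot (coboundary i N X) u = 0 <-> is_coboundary i N X (val u).
Proof.
rewrite -(linear0 (to_quot (coboundary i N X))).
split=> [/to_quotP|bu]; first by rewrite subr0 => /asboolP.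
by apply/to_quotP; rewrite subr0; apply/asboolP.
Qed.

Lemma cocycleP N (u : submod (cocycle i N X)) : is_cocycle (val u).
Proof. exact/asboolP/(valP u). Qed.

Lemma local_cohomology_torsion (z : H) :
  exists k, forall r, r \in idealX a k -> r *: z = 0.
Proof.
have [k [x [_ ->]]] := to_limit_surj z 0; exists k => r rk.
suff rx0 : r *: x = 0 by rewrite -to_limitZ rx0; exact: linear0.
rewrite -[x]to_quotK; set u := repr x.
rewrite -to_quotZ; apply/Ext_eq0.
have rQ (q : Q k) : r *: q = 0.
  rewrite -[q]to_quotK -linearZ -(linear0 (to_quot (@powM R a M k))).
  apply/to_quotP; rewrite subr0; apply: mem_span.
  by exists r => //; exists (repr q).
exact: eq_coboundary (cocycle_scale_annihilator (cocycleP u) rQ).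
Qed.

(** Both [M -> M / a^k M] (for [k] large) and [Gamma_a X -> X] become
    isomorphisms once [c] is inverted: multiplication by [c] provides maps in
    the other direction. Hence the induced map from the limit to
    Ext(M, Gamma_a X) has a kernel killed by [c^2], and the latter module is
    embedded in a quotient of a power of [Gamma_a X] by [finite_detection]. *)
Lemma local_cohomology_embedding : noetherian R -> finitely_generated M ->
  exists n (B : submodClosed ('I_n -> Y)), forall c k0,
    (forall r, r \in idealX a k0 -> c * r = 0) ->
    exists f : {linear H -> quotmod B}, forall z, f z = 0 -> c ^+ 2 *: z = 0.
Proof.
move=> noethR fgM; have [s sP] := finite_detection i noethR fgM.
pose b l := tnth (in_tuple s) l.
have cB : submod_closed [pred w : 'I_(size s) -> Y | `[< exists h,
    is_coboundary i M Y h /\ forall l, w l = h (b l) >] ].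
  split.
    by apply/asboolP; exists (fun=> 0); split=> //; apply: coboundary0.
  move=> d v w /asboolP[g [bg vg]] /asboolP[h [bh wh]]; apply/asboolP.
  exists (fun x => d *: g x + h x); split=> [|l]; first exact: coboundaryD.
  by rewrite -vg -wh.
(* [B]: the values of coboundaries on the detecting chains [b] *)
exists (size s), (bundle_submod cB) => c k0 ca.
have cX x : c *: x \in torsion a X.
  by apply/asboolP; exists k0 => r /ca cr; rewrite scalerA mulrC cr scale0r.
(* multiplication by [c], from [X] into its torsion *)
pose kappa0 x : Y := exist _ (c *: x) (cX x).
have lkappa : linear kappa0.
  by move=> d x y; apply: val_inj; rewrite /= scalerDr !scalerA mulrC.
pose kappa : {linear X -> Y} := bundle_linear lkappa.
have kappaE x : val (kappa x) = c *: x by [].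
pose proj k : {linear M -> Q k} := to_quot (@powM R a M k).
pose values k (u : submod (cocycle i (Q k) X)) : 'I_(size s) -> Y :=
  fun l => kappa (val u (res_map i (proj k) (b l))).
have lvalues k : linear (@values k).
  move=> d u v; apply/funext => l.
  rewrite -[RHS]/(d *: values k u l + values k v l) /values -linearP.
  by congr (kappa _).
have phi_ex k : exists
    phi : {linear Ext i (Q k) X -> quotmod (bundle_submod cB)},
  forall u, phi (to_quot (coboundary i (Q k) X) u) = to_quot _ (values k u).
  apply: (@quot_lift_ex _ _ _ _ (to_quot _ \o bundle_linear (lvalues k))) => u.
  move=> /asboolP bu; rewrite -(linear0 (to_quot (bundle_submod cB))).
  apply/to_quotP; rewrite subr0; apply/asboolP.
  exists (kappa \o (val u \o res_map i (proj k))); split=> //.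
  exact/coboundary_comp/coboundary_res_map.
pose phi k := projT1 (cid (phi_ex k)).
have phiE k u :
    phi k (to_quot (coboundary i (Q k) X) u) = to_quot _ (values k u).
  exact: (projT2 (cid (phi_ex k))).
have phi_trans k x : phi k.+1 (Ext_map i X (@pow_proj R a M k) x) = phi k x.
  rewrite -[x]to_quotK; set u := repr x.
  rewrite -[Ext_map _ _ _ _]/(quot_map _ _) quot_mapE !phiE.
  congr (to_quot _ _).
  apply/funext => l; congr (kappa _).
  rewrite -[LHS]/(val u
    (res_map i (@pow_proj R a M k) (res_map i (proj k.+1) (b l)))).
  congr (val u _); rewrite res_map_comp; apply: eq_res_map => y.
  exact: quot_mapE.
have [f fE] := direct_limit_lift phi_trans.
exists f => z; have [k [x [k0k ->]]] := to_limit_surj z k0.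
rewrite fE -to_limitZ -[x]to_quotK; move: (repr x) => u {z x}.
rewrite phiE -(linear0 (to_quot (bundle_submod cB))) => /to_quotP.
rewrite subr0 => /asboolP[h [bh hE]].
have [lu u0] := cocycleP u.
pose h' := kappa \o (val u \o res_map i (proj k)).
have ch' : is_cocycle h' by apply/cocycle_comp/cocycle_res_map/cocycleP.
have bh' : is_coboundary i M Y h'.
  have bd : is_coboundary i M Y (fun x => (-1) *: h x + h' x).
    apply: sP => [|x /(nthP 0)[l ls <-]].
      split=> [d x y|x]; last first.
        by rewrite (coboundary_diff bh) ch'.2 scaler0 addr0.
      rewrite (coboundary_linear bh) ch'.1 !scalerDr !scalerA.
      by rewrite (mulrC d) addrACA.
    have := hE (Ordinal ls); rewrite /b (tnth_nth 0) /= => <-.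
    by rewrite /values /b (tnth_nth 0) scaleN1r addNr.
  apply: eq_coboundary (coboundaryD 1 bh bd) => x.
  by rewrite scale1r scaleN1r addrA subrr add0r.
have [gamma gammaE] : exists gamma : {linear Q k -> M},
    forall x, gamma (proj k x) = c *: x.
  apply: (@quot_lift_ex _ _ _ _ (c \*: idfun)) => x.
  apply: (@linear_span_eq0 _ _ _ (c \*: idfun)) => _ [r rk [y _ <-]].
  by rewrite /= scalerA ca ?scale0r//; apply: idealX_sub k0k _ rk.
have pgE q : (proj k \o gamma) q = c *: q.
  by rewrite -[q]to_quotK /= gammaE linearZ.
suff cu0 : c ^+ 2 *: to_quot (coboundary i (Q k) X) u = 0.
  by rewrite cu0; exact: linear0.
rewrite -to_quotZ; apply/Ext_eq0.
(* [c^2 u] is [c] times the pullback of [u] along [proj k \o gamma], up to a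
   coboundary, and that is the pullback of [h'] along [gamma] *)
have b1 := cocycle_scale_map (cocycleP u) pgE.
have b2 : is_coboundary i (Q k) X
    (fun y => c *: val u (res_map i (proj k \o gamma) y)).
  have val_linear : linear (val : Y -> X) by [].
  have := coboundary_comp (bundle_linear val_linear)
    (coboundary_res_map gamma bh').
  apply: eq_coboundary => y; rewrite /= -res_map_comp.
  by [].
apply: eq_coboundary (coboundaryD (- c) b1 b2) => y.
rewrite -[RHS]/(c ^+ 2 *: val u y) scalerBr !scaleNr opprK scalerA.
by rewrite addrAC addNr add0r.
Qed.

End LocalCohomology.

Theorem corollary3p12 (R : comNzRingType) (m a : {pred R}) (M X : lmodType R) :
  noetherian R ->
  local_ring m ->
  krull_dim_le R 2 ->
  ideal a ->
  finitely_generated M ->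
  weakly_laskerian (submod (torsion a X)) ->
  forall i : nat, finite_set (Ass (gen_local_cohomology a M X i)).
Proof.
move=> noethR locm dim2 ha fgM wlX i.
have [E [finE EP]] := finite_nonnilpotent_locus noethR locm dim2 ha.
have [n [B embB]] := local_cohomology_embedding a X i noethR fgM.
apply: (@sub_finite_set _ _ (E `|` Ass (quotmod B))); last first.
  by rewrite finite_setU; split=> //; apply: weakly_laskerian_power.
move=> p pAss; have [pp [z pz]] := pAss.
have ap : {subset a <= p}.
  have [k zk] := local_cohomology_torsion z.
  move=> x xa; apply: (primeX pp (n := k)).
  by rewrite pz; apply/eqP/zk/exp_idealX.
have [Ep|[c [k [cp ck]]]] := EP p pp ap; [by left|right].
have [f kerf] := embB c k ck.
apply: Ass_transfer kerf pAss.
by apply/negP => /(primeX pp); apply/negP.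
Qed.
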